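(* Let $H_0,H_1>0$ and let $f:\mathbb{R}^d\to\mathbb{R}$ be $(H_0,H_1)$-smooth (not necessarily convex). Let $\theta=\frac{1}{4\sqrt2+4}$, and let $x^0,\dots,x^N$ ($N\ge1$) be generated by gradient descent with the warm-up step size $\eta_k=\theta\min\left\{\frac1{H_0},\frac1{3H_1F_k}\right\}$, where $F_k=f(x^k)-f^*$. Let $M$ be the smallest index $k\in\{0,\dots,N-1\}$ such that $F_k<\frac{H_0}{3H_1}$, with the convention $M=N$ if no such index exists. Then $$\min_{0\le k\le N-1}\|\nabla f(x^k)\|\le\begin{cases}\sqrt{\dfrac{2H_0F_0}{\theta N}},&M=0,\\[1em]\min\left\{\sqrt{\dfrac{6H_1F_0\sum_{k=0}^{M-1}F_k}{\theta M^2}},\ \sqrt{\dfrac{2H_0F_0}{\theta(N-M)}}\right\},&1\le M\le N-1,\\[1em]\sqrt{\dfrac{6H_1F_0\sum_{k=0}^{N-1}F_k}{\theta N^2}},&M=N.\end{cases}$$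
   Context: $f$ is differentiable on $\mathbb{R}^d$ and $f^*=\min_xf(x)$; $\|\cdot\|$ is the Euclidean norm. $(H_0,H_1)$-smoothness: for all $x,y\in\mathbb{R}^d$ with $\|y-x\|\le1/\sqrt{H_1}$, $\|\nabla f(y)-\nabla f(x)\|\le\big(H_0+H_1[f(x)-f^*]\big)\|y-x\|$. Gradient descent: $x^0\in\mathbb{R}^d$ is given and $x^{k+1}=x^k-\eta_k\nabla f(x^k)$ for $k=0,\dots,N-1$, with the convention $\frac1{3H_1F_k}=+\infty$ (so $\eta_k=\theta/H_0$) when $F_k=0$. *)

(* Defs.v *)
From mathcomp Require Import all_boot all_order all_algebra.
From mathcomp Require Import all_classical all_reals all_analysis.
Set Implicit Arguments.
Unset Strict Implicit.
Unset Printing Implicit Defensive.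
Import Order.TTheory GRing.Theory Num.Theory.
Import numFieldNormedType.Exports.
Local Open Scope ring_scope.

(* The norm [`|v|] on ['rV[R]_d] provided by the library is the sup norm; it
   induces the same topology, hence the same notion of differentiability, as
   the Euclidean norm, but the quantitative estimates need the latter. *)
Definition enorm (R : realType) (d : nat) (v : 'rV[R]_d) : R :=
  Num.sqrt (\sum_(i < d) v 0 i ^+ 2).

Definition grad (R : realType) (d : nat) (f : 'rV[R]_d -> R)
    (x : 'rV[R]_d) : 'rV[R]_d :=
  \row_(i < d) 'D_(delta_mx 0 i) f x.

Definition is_min_value (R : realType) (T : Type) (f : T -> R) (fstar : R) :
    Prop :=
  (exists x, f x = fstar) /\ (forall x, fstar <= f x).

Definition H0H1_smooth (R : realType) (d : nat) (H0 H1 : R)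
    (f : 'rV[R]_d -> R) (fstar : R) : Prop :=
  forall x y : 'rV[R]_d, enorm (y - x) <= 1 / Num.sqrt H1 ->
    enorm (grad f y - grad f x) <=
      (H0 + H1 * (f x - fstar)) * enorm (y - x).

(* The value 0 of the gap is treated separately because [0^-1 = 0] in the
   library, whereas here [1 / (3 * H1 * 0)] has to be read as [+oo]. *)
Definition warmup_step (R : realType) (H0 H1 theta Fk : R) : R :=
  if Fk == 0 then theta / H0
  else theta * Num.min (1 / H0) (1 / (3 * H1 * Fk)).

Definition gradient_descent (R : realType) (d : nat) (f : 'rV[R]_d -> R)
    (eta : nat -> R) (N : nat) (x : nat -> 'rV[R]_d) : Prop :=
  forall k : nat, (k < N)%N -> x k.+1 = x k - eta k *: grad f (x k).

(* The smallest [k < N] such that [P k], or [N] if there is none. *)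
Definition first_index (N : nat) (P : pred nat) : nat :=
  \big[minn/N]_(0 <= k < N | P k) k.

(* The minimum of [u 0, ..., u (N - 1)] for [0 < N]; the neutral value [u 0] is
   one of the terms, so it does not affect the result. *)
Definition min_below (R : realType) (N : nat) (u : nat -> R) : R :=
  \big[Num.min/u 0%N]_(0 <= k < N) u k.

(* Main.v *)
Require Import Defs.
From mathcomp Require Import all_boot all_order all_algebra.
From mathcomp Require Import all_classical all_reals all_analysis.
From mathcomp Require Import ring lra.
Import Order.TTheory GRing.Theory Num.Theory.
Import numFieldNormedType.Exports.
Local Open Scope ring_scope.

(** Along a segment from [x] to [x + v] no longer than [1 / sqrt H1], the
    gradient moves away from [grad f x] at rate at most
    [L = H0 + H1 * (f x - fstar)] in the distance to [x], so the usual
    quadratic upper bound [smooth_descent] holds with this local constant.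
    Applied to a step along [- grad f x] of length at most [1 / sqrt H1], and
    combined with [fstar <= f], it yields [smooth_grad_sqr_le]: the squared
    gradient norm is at most [4 * L * (f x - fstar)].

    The warm-up step satisfies [eta * H0 <= theta] and
    [eta * 3 * H1 * F <= theta], hence [eta * L <= 4 * theta / 3]. Together
    with the gradient bound this shows that the gradient step is no longer than
    [1 / sqrt H1], so that the quadratic bound applies to it and gives
    [F (k + 1) <= F k - (eta k / 2) * g k ^ 2] ([smooth_step_descent]), where
    [g k] is the norm of the gradient at the [k]-th iterate.

    Let [m] be the smallest of the [g k]. Telescoping over any block of
    iterations bounds [(sum of the eta k) * m ^ 2] by [2 * F 0]
    ([sum_decrease_le]). The gap is at least [H0 / (3 * H1)] before the index
    [M], by minimality of [M], and less than that from [M] on, since [F]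
    decreases. On the second block [eta k = theta / H0], which gives the rate
    in [N - M]. On the first block [eta k = theta / (3 * H1 * F k)], and the
    inequality [M ^ 2 <= (sum of F k) * (sum of 1 / F k)] gives the rate in
    [M]. The three cases of the theorem are the second bound, both, and the
    first. *)

(** * Euclidean inner product *)

Definition edot {R : realType} {d : nat} (u v : 'rV[R]_d) : R :=
  \sum_(i < d) u 0 i * v 0 i.

Lemma enorm_ge0 {R : realType} {d : nat} (v : 'rV[R]_d) : 0 <= enorm v.
Proof. exact: sqrtr_ge0. Qed.

Lemma edotvv {R : realType} {d : nat} (v : 'rV[R]_d) :
  edot v v = enorm v ^+ 2.
Proof.
rewrite /enorm sqr_sqrtr; last by apply: sumr_ge0 => i _; exact: sqr_ge0.
by apply: eq_bigr => i _; rewrite expr2.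
Qed.

Lemma edotZr {R : realType} {d : nat} (a : R) (u v : 'rV[R]_d) :
  edot u (a *: v) = a * edot u v.
Proof.
by rewrite /edot mulr_sumr; apply: eq_bigr => i _; rewrite mxE mulrCA.
Qed.

Lemma edotBl {R : realType} {d : nat} (u v w : 'rV[R]_d) :
  edot (u - v) w = edot u w - edot v w.
Proof.
by rewrite /edot -sumrB; apply: eq_bigr => i _; rewrite !mxE mulrBl.
Qed.

Lemma edotC {R : realType} {d : nat} (u v : 'rV[R]_d) : edot u v = edot v u.
Proof. by apply: eq_bigr => i _; rewrite mulrC. Qed.

Lemma enormZ {R : realType} {d : nat} (a : R) (v : 'rV[R]_d) :
  enorm (a *: v) = `|a| * enorm v.
Proof.
rewrite /enorm -sqrtr_sqr -sqrtrM ?sqr_ge0// mulr_sumr; congr Num.sqrt.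
by apply: eq_bigr => i _; rewrite mxE exprMn.
Qed.

(** A sum of squares vanishes only if every term does, so [v] is zero. *)
Lemma edot_enorm0 {R : realType} {d : nat} (u v : 'rV[R]_d) :
  enorm v = 0 -> edot u v = 0.
Proof.
move=> v0.
have /psumr_eq0P vi0 : \sum_(i < d) v 0 i ^+ 2 = 0.
  rewrite -[LHS]sqr_sqrtr ?sumr_ge0// -/(enorm v) ?v0 ?expr0n// => i _.
  exact: sqr_ge0.
rewrite /edot big1// => i _.
have /eqP : v 0 i ^+ 2 = 0 by apply: vi0 => // j _; exact: sqr_ge0.
by rewrite sqrf_eq0 => /eqP ->; rewrite mulr0.
Qed.

(** Cauchy-Schwarz, from [0 <= |w| ^ 2] for [w = |v| u - |u| v]; the expansion
    of [|w| ^ 2] is [2 |u| |v| (|u| |v| - <u, v>)]. *)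
Lemma edot_le {R : realType} {d : nat} (u v : 'rV[R]_d) :
  edot u v <= enorm u * enorm v.
Proof.
have [u0|un0] := eqVneq (enorm u) 0.
  by rewrite edotC edot_enorm0// u0 mul0r.
have [v0|vn0] := eqVneq (enorm v) 0; first by rewrite edot_enorm0// v0 mulr0.
set w := enorm v *: u - enorm u *: v.
have := sqr_ge0 (enorm w); rewrite -edotvv {1}/w edotBl.
rewrite ![edot (_ *: _) w]edotC !edotZr ![edot w _]edotC.
rewrite /w ![edot _ (_ - _)]edotC !edotBl.
rewrite ![edot (_ *: _) _]edotC !edotZr !edotvv [edot v u]edotC.
have : 0 < enorm u * enorm v by rewrite mulr_gt0 ?lt0r ?un0 ?vn0 ?enorm_ge0.
set a := enorm u; set b := enorm v; set c := edot u v => ab_gt0 H.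
suff : 0 <= (a * b - c) by lra.
rewrite -(pmulr_rge0 _ ab_gt0).
have -> : a * b * (a * b - c) =
  (b * (b * a ^+ 2 - a * c) - a * (b * c - a * b ^+ 2)) / 2 by field.
by rewrite divr_ge0.
Qed.

(** * Local quadratic upper bound *)

Lemma derive_grad {R : realType} {d : nat} (f : 'rV[R]_d -> R)
    (z v : 'rV[R]_d) :
  differentiable f z -> 'D_v f z = edot (grad f z) v.
Proof.
move=> fz; rewrite deriveE// {1}(row_sum_delta v) linear_sum.
by apply: eq_bigr => i _; rewrite linearZ /= mxE deriveE// mulrC.
Qed.

Lemma is_derive_line {R : realType} {d : nat} (f : 'rV[R]_d -> R)
    (x v : 'rV[R]_d) (t : R) :
  differentiable f (x + t *: v) ->
  is_derive t 1 (fun s : R => f (x + s *: v)) (edot (grad f (x + t *: v)) v).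
Proof.
move=> fz.
(* Both sides are the same difference quotient, since
   [x + (h + t) v = (x + t v) + h v]. *)
have quotientE : (fun h : R =>
    h^-1 *: (((fun s : R => f (x + s *: v)) \o shift t) (h *: (1 : R)) -
             f (x + t *: v))) =
    (fun h : R => h^-1 *: ((f \o shift (x + t *: v)) (h *: v) -
             f (x + t *: v))).
  apply/funext => h /=; congr (_ *: (f _ - _)).
  by rewrite scalerDl addrCA /GRing.scale /= mulr1.
split; first by rewrite /derivable quotientE; exact: diff_derivable.
by rewrite /derive quotientE -/(derive f (x + t *: v) v) derive_grad.
Qed.

(** The function [h t = f (x + t v) - t <grad f x, v> - t ^ 2 L |v| ^ 2 / 2] is
    nonincreasing on the unit interval: its derivative is
    [<grad f (x + t v) - grad f x, v> - t L |v| ^ 2], which Cauchy-Schwarz and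
    the smoothness condition make nonpositive.  The claim is [h 1 <= h 0]. *)
Lemma smooth_descent {R : realType} {d : nat} (H0 H1 : R)
    (f : 'rV[R]_d -> R) (fstar : R) (x v : 'rV[R]_d) :
  (forall z, differentiable f z) -> H0H1_smooth H0 H1 f fstar ->
  enorm v <= 1 / Num.sqrt H1 ->
  f (x + v) <= f x + edot (grad f x) v +
    (H0 + H1 * (f x - fstar)) / 2 * enorm v ^+ 2.
Proof.
move=> f_diff f_smooth v_small.
set L := H0 + _; set n := enorm v; set g0 := edot (grad f x) v.
pose h (t : R) := f (x + t *: v) - (g0 * t + L / 2 * n ^+ 2 * t ^+ 2).
pose dh (t : R) := edot (grad f (x + t *: v)) v - (g0 + L * n ^+ 2 * t).
have h_derive (t : R) : is_derive t 1 h (dh t).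
  have fd := is_derive_line f x v t (f_diff _).
  have qd : is_derive t 1 (fun s : R => g0 * s + L / 2 * n ^+ 2 * s ^+ 2)
      (g0 + L * n ^+ 2 * t).
    by apply: is_derive_eq; rewrite /GRing.scale /=; field.
  exact: is_deriveB.
have [|c c01] := @MVT R h dh 0 1 ltr01 (fun t _ => h_derive t).
  apply: continuous_subspaceT => t.
  by apply/differentiable_continuous/derivable1_diffP; case: (h_derive t).
rewrite subr0 mulr1 /h scale1r scale0r addr0 => mvt.
have dhc_le0 : dh c <= 0.
  move: c01; rewrite in_itv /= => /andP[c0 c1].
  have cn : enorm (x + c *: v - x) = c * n.
    by rewrite addrC addKr enormZ gtr0_norm.
  have := f_smooth x (x + c *: v); rewrite cn -/L => smooth_c.
  have n_ge0 : 0 <= n := enorm_ge0 v.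
  have cn_le : c * n <= 1 / Num.sqrt H1.
    by apply: le_trans v_small; rewrite ler_piMl// ltW.
  have := edot_le (grad f (x + c *: v) - grad f x) v.
  rewrite edotBl -/g0 -/n => CS.
  have := ler_wpM2r n_ge0 (smooth_c cn_le); rewrite /dh; lra.
lra.
Qed.

(** Descending from [x] by [s] times the gradient cannot go below [fstar].
    With [n = |grad f x|] and [r = 1 / sqrt H1], the minimizer [s = 1 / L] of
    the quadratic bound is admissible when [n <= L r] and gives
    [n ^ 2 <= 2 L F].  Otherwise the longest admissible step [s = r / n] gives
    [r n <= 2 F], that is [n ^ 2 <= 4 H1 F ^ 2], and [H1 F <= L]. *)
Lemma smooth_grad_sqr_le {R : realType} {d : nat} (H0 H1 : R)
    (f : 'rV[R]_d -> R) (fstar : R) (x : 'rV[R]_d) :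
  0 < H0 -> 0 < H1 -> (forall z, differentiable f z) ->
  (forall z, fstar <= f z) -> H0H1_smooth H0 H1 f fstar ->
  enorm (grad f x) ^+ 2 <=
    4 * (H0 + H1 * (f x - fstar)) * (f x - fstar).
Proof.
move=> H0_gt0 H1_gt0 f_diff f_ge f_smooth.
have descent := smooth_descent H0 H1 f fstar x _ f_diff f_smooth.
set g := grad f x in descent *; set n := enorm g.
have n_ge0 : 0 <= n := enorm_ge0 g.
set F := f x - fstar in descent *; have F_ge0 : 0 <= F by rewrite subr_ge0.
set L := H0 + H1 * F in descent *.
have HF_ge0 : 0 <= H1 * F by rewrite mulr_ge0// ltW.
have L_gt0 : 0 < L by rewrite /L; lra.
set r := 1 / Num.sqrt H1 in descent.
have r_gt0 : 0 < r by rewrite divr_gt0 ?sqrtr_gt0.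
have rH1 : H1 * r ^+ 2 = 1.
  by rewrite /r expr_div_n sqr_sqrtr ?ltW// expr1n mul1r divff ?gt_eqF.
have step (s : R) : 0 <= s -> s * n <= r ->
    s * n ^+ 2 - L / 2 * (s * n) ^+ 2 <= F.
  move=> s_ge0 sn.
  have vn : enorm (- s *: g) = s * n by rewrite enormZ normrN ger0_norm.
  have := descent (- s *: g); rewrite vn edotZr edotvv -/n => /(_ sn).
  by have := f_ge (x + - s *: g); rewrite /F; lra.
have [n_le|n_gt] := leP n (L * r).
  have /step : L^-1 * n <= r by rewrite mulrC ler_pdivrMr// mulrC.
  rewrite invr_ge0 (ltW L_gt0) => /(_ isT).
  have -> : L^-1 * n ^+ 2 - L / 2 * (L^-1 * n) ^+ 2 = n ^+ 2 / (2 * L).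
    by field; rewrite gt_eqF.
  rewrite ler_pdivrMr ?mulr_gt0// => n2_le.
  have := mulr_ge0 F_ge0 (ltW L_gt0); lra.
have n_gt0 : 0 < n by rewrite (lt_trans _ n_gt)// mulr_gt0.
have /step : r / n * n <= r by rewrite divfK// gt_eqF.
rewrite divr_ge0 ?(ltW r_gt0)// => /(_ isT).
have -> : r / n * n ^+ 2 - L / 2 * (r / n * n) ^+ 2 = r * n - L / 2 * r ^+ 2.
  by field; rewrite gt_eqF.
have := ltW n_gt; rewrite -(ler_pM2r r_gt0) => Lr2 rn_le.
have rn2 : r * n <= 2 * F by lra.
have rn_ge0 : 0 <= r * n by rewrite mulr_ge0// ltW.
have rn_sqr : (r * n) ^+ 2 <= (2 * F) ^+ 2 by rewrite lerXn2r ?nnegrE ?mulr_ge0.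
have -> : n ^+ 2 = H1 * (r * n) ^+ 2 by rewrite exprMn mulrA rH1 mul1r.
apply: (@le_trans _ _ (H1 * (2 * F) ^+ 2)); first by rewrite ler_pM2l.
have := mulr_ge0 (ltW H0_gt0) F_ge0; rewrite /L; lra.
Qed.

(** The squared step length is at most [4 (eta L) (eta F)] by the gradient
    bound, hence at most [1 / H1] since [eta L <= 1] and
    [eta * 3 H1 F <= 3 / 4].  The quadratic bound then applies, and [eta L <= 1]
    leaves at least half of the first-order decrease. *)
Lemma smooth_step_descent {R : realType} {d : nat} (H0 H1 theta eta : R)
    (f : 'rV[R]_d -> R) (fstar : R) (x : 'rV[R]_d) :
  0 < H0 -> 0 < H1 -> (forall z, differentiable f z) ->
  (forall z, fstar <= f z) -> H0H1_smooth H0 H1 f fstar ->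
  theta <= 3 / 4 -> 0 <= eta ->
  eta * H0 <= theta -> eta * (3 * H1 * (f x - fstar)) <= theta ->
  f (x - eta *: grad f x) <= f x - eta / 2 * enorm (grad f x) ^+ 2.
Proof.
move=> H0_gt0 H1_gt0 f_diff f_ge f_smooth theta_le eta_ge0 etaH0 etaF.
have := smooth_grad_sqr_le H0 H1 f fstar x H0_gt0 H1_gt0 f_diff f_ge f_smooth.
have := smooth_descent H0 H1 f fstar x (- eta *: grad f x) f_diff f_smooth.
rewrite enormZ normrN (ger0_norm eta_ge0) edotZr edotvv scaleNr.
set n := enorm _; set F := f x - fstar in etaF *; set L := H0 + H1 * F.
move=> descent n_le.
have n_ge0 : 0 <= n by exact: enorm_ge0.
have F_ge0 : 0 <= F by rewrite subr_ge0.
have etaL : eta * L <= 1 by rewrite /L; lra.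
have etaL_ge0 : 0 <= eta * L.
  by rewrite mulr_ge0 // addr_ge0 ?mulr_ge0 // ltW.
have etaHF_ge0 : 0 <= eta * (3 * H1 * F) by rewrite !mulr_ge0 // ltW.
have short : eta * n <= 1 / Num.sqrt H1.
  rewrite ler_pdivlMr ?sqrtr_gt0// -(@expr_le1 _ 2)//; last first.
    by rewrite !mulr_ge0 ?sqrtr_ge0.
  rewrite !exprMn (sqr_sqrtr (ltW H1_gt0)).
  apply: (@le_trans _ _ (eta ^+ 2 * (4 * L * F) * H1)).
    by rewrite ler_pM2r// ler_wpM2l// sqr_ge0.
  have : (eta * L) * (eta * (3 * H1 * F)) <= 1 * (3 / 4).
    by rewrite ler_pM//; lra.
  lra.
have n2_ge0 : 0 <= eta * n ^+ 2 by rewrite mulr_ge0// sqr_ge0.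
have := ler_wpM2r n2_ge0 etaL; have := descent short; lra.
Qed.

(** * Warm-up step size *)

Lemma warmup_stepP {R : realType} (H0 H1 theta F : R) :
  0 < H0 -> 0 < H1 -> 0 <= theta -> 0 <= F ->
  let eta := warmup_step H0 H1 theta F in
  [/\ 0 <= eta, eta * H0 <= theta & eta * (3 * H1 * F) <= theta].
Proof.
move=> H0_gt0 H1_gt0 theta_ge0 F_ge0 /=; rewrite /warmup_step.
have [->|Fn0] := eqVneq F 0.
  by split; rewrite ?mulr0// ?divr_ge0 ?divfK ?gt_eqF// ltW.
have F_gt0 : 0 < F by rewrite lt0r Fn0.
have HF_gt0 : 0 < 3 * H1 * F by rewrite !mulr_gt0.
split.
- by rewrite mulr_ge0// le_min !divr_ge0// ltW.
- by rewrite -ler_pdivlMr// ler_wpM2l// !div1r ge_min lexx.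
- by rewrite -ler_pdivlMr// ler_wpM2l// !div1r ge_min lexx orbT.
Qed.

Lemma warmup_step_small {R : realType} (H0 H1 theta F : R) :
  0 < H0 -> 0 < H1 -> 0 <= F -> F <= H0 / (3 * H1) ->
  warmup_step H0 H1 theta F = theta / H0.
Proof.
move=> H0_gt0 H1_gt0 F_ge0 F_le; rewrite /warmup_step.
have [//|Fn0] := eqVneq F 0.
have F_gt0 : 0 < F by rewrite lt0r Fn0.
rewrite min_l ?div1r// lef_pV2 ?posrE ?mulr_gt0//.
by rewrite -ler_pdivlMl ?mulr_gt0// mulrC.
Qed.

Lemma warmup_step_large {R : realType} (H0 H1 theta F : R) :
  0 < H0 -> 0 < H1 -> H0 / (3 * H1) <= F ->
  warmup_step H0 H1 theta F = theta / (3 * H1) * F^-1.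
Proof.
move=> H0_gt0 H1_gt0 F_ge; rewrite /warmup_step.
have F_gt0 : 0 < F by rewrite (lt_le_trans _ F_ge)// divr_gt0 ?mulr_gt0.
rewrite gt_eqF// min_r ?div1r; first by rewrite invfM mulrA.
rewrite lef_pV2 ?posrE ?mulr_gt0//.
by rewrite -ler_pdivrMl ?mulr_gt0// mulrC.
Qed.

(** * Averaging along the trajectory *)

(** The harmonic mean is at most the arithmetic mean [a = S / n]: sum the
    tangent line inequality [2 / a - y / a ^ 2 <= 1 / y] over the values
    [y = F k]. *)
Lemma sqr_size_le_sum_inv {R : realType} (F : nat -> R) (n : nat) :
  (forall k, (k < n)%N -> 0 < F k) ->
  n%:R ^+ 2 <= (\sum_(0 <= k < n) F k) * \sum_(0 <= k < n) (F k)^-1.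
Proof.
case: n => [|n] F_gt0; first by rewrite expr0n !big_nil mulr0.
set S := \sum_(0 <= k < n.+1) F k; set m : R := n.+1%:R.
have S_gt0 : 0 < S.
  rewrite /S big_nat_recr//= ltr_wpDl ?F_gt0//.
  by rewrite big_nat sumr_ge0// => k /andP[_ kn]; rewrite ltW ?F_gt0// ltnW.
have tangent k : (0 <= k < n.+1)%N -> m / S * 2 - (m / S) ^+ 2 * F k <= (F k)^-1.
  move=> /andP[_ /F_gt0 Fk]; rewrite -[leRHS]mul1r ler_pdivlMr//.
  have := sqr_ge0 (m / S * F k - 1); lra.
have := ler_sum_nat tangent.
rewrite sumrB sumr_const_nat subn0 -mulr_sumr -/S => H.
rewrite mulrC -ler_pdivrMr//; apply: le_trans H.
rewrite -mulr_natr -/m le_eqVlt; apply/orP; left; apply/eqP.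
by field; rewrite gt_eqF.
Qed.

(** Telescoping from index [0] rather than from [a] produces [F 0] directly;
    the extra terms are nonnegative. *)
Lemma sum_decrease_le {R : realType} (F eta : nat -> R) (c : R) (a b N : nat) :
  (a <= b <= N)%N -> 0 <= c -> (forall k, 0 <= F k) -> (forall k, 0 <= eta k) ->
  (forall k, (k < N)%N -> eta k / 2 * c <= F k - F k.+1) ->
  (\sum_(a <= k < b) eta k) * c <= 2 * F 0%N.
Proof.
move=> /andP[ab bN] c_ge0 F_ge0 eta_ge0 decr.
have from0 : (\sum_(0 <= k < b) eta k) * c <= 2 * F 0%N.
  have : \sum_(0 <= k < b) (F k.+1 - F k) <= \sum_(0 <= k < b) - (eta k / 2 * c).
    apply: ler_sum_nat => k /andP[_ kb].
    by have := decr k (leq_trans kb bN); lra.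
  rewrite telescope_sumr// sumrN -!mulr_suml; have := F_ge0 b; lra.
apply: le_trans from0; rewrite ler_wpM2r// (@big_cat_nat _ _ _ a 0 b)//=.
by rewrite lerDr sumr_ge0.
Qed.

Lemma first_indexP (N : nat) (P : pred nat) (M := first_index N P) :
  [/\ (M <= N)%N, forall k, (k < M)%N -> ~~ P k & (M < N)%N -> P M].
Proof.
have [leN lek eqN] : [/\ (M <= N)%N,
    {in index_iota 0 N, forall k, P k -> (M <= k)%N} & M = N \/ P M].
  rewrite /M /first_index; elim: (index_iota 0 N) => [|j s [sN sk sP]].
    by rewrite big_nil; split; [| |left].
  rewrite big_cons; case: ifP => [Pj|nPj].
    split; first by rewrite geq_min sN orbT.
    - by move=> k; rewrite in_cons geq_min => /orP[/eqP ->|/sk ks /ks ->];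
        rewrite ?leqnn ?orbT.
    - by rewrite /minn; case: ifP; [right|].
  by split=> // k; rewrite in_cons => /orP[/eqP ->|/sk//]; rewrite nPj.
split=> // [k kM|MN]; last by case: eqN MN => // ->; rewrite ltnn.
apply/negP => Pk; have := lek k; rewrite mem_index_iota leq0n/=.
by rewrite (leq_trans kM leN) leqNgt kM => /(_ isT Pk).
Qed.

Lemma min_below_le {R : realType} (N : nat) (u : nat -> R) (k : nat) :
  (k < N)%N -> min_below N u <= u k.
Proof.
by move=> kN; apply: bigmin_inf_seq (lexx _) => //; rewrite mem_index_iota.
Qed.

Lemma le_min_below {R : realType} (N : nat) (u : nat -> R) (c : R) :
  (forall k, c <= u k) -> c <= min_below N u.
Proof. by move=> cu; apply: le_bigmin. Qed.

(** * The convergence rate *)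

Lemma rate_bound {R : realType} (g T N D : R) :
  0 <= g -> 0 < T -> 0 < N -> N * (T * g ^+ 2) <= D -> g <= Num.sqrt (D / (T * N)).
Proof.
move=> g_ge0 T_gt0 N_gt0 H; rewrite -[leLHS]ger0_norm// -sqrtr_sqr ler_wsqrtr//.
by rewrite ler_pdivlMr ?mulr_gt0//; lra.
Qed.

Theorem theoremC16 (R : realType) (d : nat) (H0 H1 : R)
    (f : 'rV[R]_d -> R) (fstar : R) (N : nat) (x : nat -> 'rV[R]_d)
    (H0_gt0 : 0 < H0) (H1_gt0 : 0 < H1)
    (f_diff : forall z : 'rV[R]_d, differentiable f z)
    (f_min : is_min_value f fstar)
    (f_smooth : H0H1_smooth H0 H1 f fstar)
    (N_ge1 : (1 <= N)%N) :
  let theta : R := 1 / (4 * Num.sqrt 2 + 4) in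
  let F := fun k : nat => f (x k) - fstar in
  let M := first_index N (fun k => F k < H0 / (3 * H1)) in
  gradient_descent f (fun k => warmup_step H0 H1 theta (F k)) N x ->
  min_below N (fun k => enorm (grad f (x k))) <=
    if M == 0%N then
      Num.sqrt (2 * H0 * F 0%N / (theta * N%:R))
    else if (M <= N.-1)%N then
      Num.min
        (Num.sqrt (6 * H1 * F 0%N * (\sum_(0 <= k < M) F k)
                   / (theta * M%:R ^+ 2)))
        (Num.sqrt (2 * H0 * F 0%N / (theta * (N - M)%:R)))
    else
      Num.sqrt (6 * H1 * F 0%N * (\sum_(0 <= k < N) F k)
                / (theta * N%:R ^+ 2)).
Proof.
move=> theta F M gd.
have [_ f_ge] := f_min.
have sqrt2_ge0 : 0 <= Num.sqrt 2 :> R by exact: sqrtr_ge0.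
have den_gt0 : 0 < 4 * Num.sqrt 2 + 4 :> R by lra.
have theta_gt0 : 0 < theta by rewrite divr_gt0.
have theta_le : theta <= 3 / 4 by rewrite ler_pdivrMr//; lra.
have F_ge0 k : 0 <= F k by rewrite subr_ge0.
set g := fun k : nat => enorm (grad f (x k)).
set m := min_below N g.
have m_ge0 : 0 <= m by apply: le_min_below => k; exact: enorm_ge0.
pose eta k := warmup_step H0 H1 theta (F k).
have etaP k := warmup_stepP H0 H1 theta (F k) H0_gt0 H1_gt0 (ltW theta_gt0)
  (F_ge0 k).
have eta_ge0 k : 0 <= eta k by case: (etaP k).
have step k : (k < N)%N -> eta k / 2 * g k ^+ 2 <= F k - F k.+1.
  move=> kN; have [_ etaH0 etaF] := etaP k.
  have := smooth_step_descent H0 H1 theta (eta k) f fstar (x k) H0_gt0 H1_gt0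
    f_diff f_ge f_smooth theta_le (eta_ge0 k) etaH0 etaF.
  by rewrite -(gd k kN) /F /g; lra.
have F_decr k : (k < N)%N -> F k.+1 <= F k.
  move=> kN; rewrite -subr_ge0 (le_trans _ (step k kN))//.
  by rewrite mulr_ge0 ?sqr_ge0// divr_ge0.
have step_min k : (k < N)%N -> eta k / 2 * m ^+ 2 <= F k - F k.+1.
  move=> kN; apply: le_trans (step k kN); rewrite ler_wpM2l ?divr_ge0//.
  by rewrite lerXn2r ?nnegrE ?min_below_le// enorm_ge0.
have [MN M_large M_small] := first_indexP N (fun k => F k < H0 / (3 * H1)).
rewrite -/M in MN M_large M_small.
have F_large k : (k < M)%N -> H0 / (3 * H1) <= F k.
  by move=> /M_large; rewrite -leNgt.
(* The gap is below the threshold at [M] and decreases afterwards. *)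
have F_small k : (M <= k < N)%N -> F k <= H0 / (3 * H1).
  elim: k => [|k IHk] /andP[Mk kN].
    by move: Mk M_small; rewrite leqn0 => /eqP -> /(_ kN) /ltW.
  move: Mk; rewrite leq_eqVlt => /orP[/eqP Mk|Mk].
    by rewrite -Mk ltW// M_small// Mk.
  by rewrite (le_trans (F_decr k (ltnW kN)))// IHk// -ltnS Mk ltnW.
have small_rate : (M < N)%N ->
    m <= Num.sqrt (2 * H0 * F 0%N / (theta * (N - M)%:R)).
  move=> MltN; apply: rate_bound => //; first by rewrite ltr0n subn_gt0.
  have := sum_decrease_le F eta (m ^+ 2) M N N.
  rewrite MN leqnn sqr_ge0 => /(_ isT isT F_ge0 eta_ge0 step_min).
  rewrite (eq_big_nat _ _ (F2 := fun=> theta / H0)); last first.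
    by move=> k kMN; rewrite /eta warmup_step_small// F_small.
  rewrite sumr_const_nat -mulr_natr -(ler_pM2l H0_gt0).
  by congr (_ <= _); field; rewrite ?gt_eqF.
have large_rate : (0 < M)%N ->
    m <= Num.sqrt (6 * H1 * F 0%N * (\sum_(0 <= k < M) F k)
                   / (theta * M%:R ^+ 2)).
  move=> M_gt0; apply: rate_bound => //; first by rewrite exprn_gt0// ltr0n.
  have F_gt0 k : (k < M)%N -> 0 < F k.
    by move=> /F_large; apply: lt_le_trans; rewrite divr_gt0 ?mulr_gt0.
  have := sum_decrease_le F eta (m ^+ 2) 0 M N.
  rewrite leq0n MN sqr_ge0 => /(_ isT isT F_ge0 eta_ge0 step_min).
  rewrite (eq_big_nat _ _ (F2 := fun k => theta / (3 * H1) * (F k)^-1)); last first.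
    by move=> k /andP[_ kM]; rewrite /eta warmup_step_large// F_large.
  rewrite -mulr_sumr.
  have := sqr_size_le_sum_inv F M F_gt0.
  have : 0 <= \sum_(0 <= k < M) F k by exact: sumr_ge0.
  set S := \sum_(0 <= k < M) F k; set I := \sum_(0 <= k < M) (F k)^-1.
  move=> S_ge0 SI total.
  apply: (@le_trans _ _ (S * I * (theta * m ^+ 2))).
    by rewrite ler_wpM2r// mulr_ge0 ?sqr_ge0// ltW.
  have S3_ge0 : 0 <= 3 * H1 * S by rewrite !mulr_ge0 // ltW.
  have := ler_wpM2l S3_ge0 total.
  have -> : 3 * H1 * S * (theta / (3 * H1) * I * m ^+ 2) =
            S * I * (theta * m ^+ 2) by field; rewrite gt_eqF.
  lra.
have [M0|M_neq0] := eqVneq M 0%N.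
  by move: small_rate; rewrite M0 subn0; apply.
have M_gt0 : (0 < M)%N by rewrite lt0n.
have [MltN|NleM] := leqP M N.-1.
  by rewrite le_min large_rate// small_rate// (leq_ltn_trans MltN)// ltn_predL.
have M_N : M = N by apply/eqP; rewrite eqn_leq MN -(prednK N_ge1).
by move: (large_rate M_gt0); rewrite M_N.
Qed.
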